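(* Let $N\ge 1$ and let $X^{(j)}=(x^{(j)}_k: k\in\mathbb{N})$, $j=1,\dots,N$, be $\Re$-Leja sequences (not necessarily distinct). For $k\in\mathbb{N}$ define $$\mathbf{P}_k=\Big\{(x^{(1)}_{\alpha_1},\dots,x^{(N)}_{\alpha_N}) : \alpha=(\alpha_1,\dots,\alpha_N)\in\mathbb{N}^N,\ \sum_{j=1}^N\alpha_j\le k\Big\}\subset[-1,1]^N .$$ Then the Lebesgue constant $\Delta(\mathbf{P}_k)$ grows at most like a polynomial in $k$ as $k\to\infty$; that is, there exist constants $C,q>0$ such that $\Delta(\mathbf{P}_k)\le C k^q$ for all $k\ge 1$.
   Context: $\mathbb{N}=\{0,1,2,\dots\}$. Let $D=\{z\in\mathbb{C}: |z|\le 1\}$. A Leja sequence (for $D$) is a sequence $E=(e_k: k\in\mathbb{N})$ of points of $D$ with $e_0=1$ and, for every $j\ge 1$, $\prod_{m=0}^{j-1}|e_j-e_m|=\max_{z\in D}\prod_{m=0}^{j-1}|z-e_m|$. A $\Re$-Leja sequence is a sequence $X=X(E)$ in $[-1,1]$ for which there is a Leja sequence $E=(e_k:k\in\mathbb{N})$ such that $X$ is obtained from the sequence of real parts $(\Re(e_k): k\in\mathbb{N})$ by eliminating repeated values (each value is kept only at its first occurrence, the order being preserved). It is known that $\mathbf{P}_k$ is a valid (unisolvent) set for interpolation by polynomials in $N$ variables of total degree at most $k$: for every function $f$ on $\mathbf{P}_k$ there is a unique such polynomial $\mathbf{L}[\mathbf{P}_k;f]$ agreeing with $f$ on $\mathbf{P}_k$.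 The Lebesgue constant $\Delta(\mathbf{P}_k)$ is the operator norm of $f\mapsto \mathbf{L}[\mathbf{P}_k;f]$ on $C([-1,1]^N)$ with the sup norm; equivalently $\Delta(\mathbf{P}_k)=\max_{x\in[-1,1]^N}\sum_{a\in\mathbf{P}_k}|\ell(\mathbf{P}_k,a;x)|$, where $\ell(\mathbf{P}_k,a;\cdot)$ is the unique polynomial of total degree at most $k$ equal to $1$ at $a$ and to $0$ at the other points of $\mathbf{P}_k$. *)

(* Defs.v *)
From HB Require Import structures.
From mathcomp Require Import all_boot all_order all_algebra.
From mathcomp Require Import complex.
From mathcomp Require Import all_classical all_reals all_analysis.
(* The notations of [mpoly] clash with those of mathcomp-analysis. *)
From mathcomp Require Import -(notations) mpoly.
Import Order.TTheory GRing.Theory Num.Theory.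
Import numFieldNormedType.Exports.

Set Implicit Arguments.
Unset Strict Implicit.
Unset Printing Implicit Defensive.

Local Open Scope classical_set_scope.
Local Open Scope ring_scope.

Definition disk (R : realType) : set R[i] := [set z | `|z| <= 1].

Definition is_leja (R : realType) (e : nat -> R[i]) : Prop :=
  [/\ e 0%N = 1,
      forall j, disk (e j)
    & forall j, (0 < j)%N -> forall z, disk z ->
        \prod_(m < j) `|z - e m| <= \prod_(m < j) `|e j - e m| ].

(* [phi] lists in increasing order the indices of the first occurrences of the
   values of the sequence of real parts. *)
Definition is_re_leja (R : realType) (X : nat -> R) : Prop :=
  exists e : nat -> R[i], is_leja e /\
  exists phi : nat -> nat,
    [/\ {homo phi : m n / (m < n)%N},
        range phi =
          [set n | forall m, (m < n)%N -> complex.Re (e m) <> complex.Re (e n)]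
      & forall k, X k = complex.Re (e (phi k))].

Definition cube (R : realType) (N : nat) : set 'rV[R]_N :=
  [set x | forall i, -1 <= x 0 i <= 1].

Definition nodes (R : realType) (N : nat) (X : 'I_N -> nat -> R) (k : nat) :
    set 'rV[R]_N :=
  [set \row_j X j (alpha j) |
    alpha in [set alpha : 'I_N -> nat | (\sum_j alpha j <= k)%N]].

Definition mpeval (R : realType) (N : nat) (p : mpoly N R) (x : 'rV[R]_N) : R :=
  meval (fun i => x 0 i) p.

(* [msize p] is the total degree plus one (and 0 when [p = 0]), so the
   bound says that [p] has total degree at most [k].  The default value 0 of
   [xget] is irrelevant as soon as [A] is unisolvent for total degree [k]. *)
Definition interpolant (R : realType) (N : nat) (k : nat) (A : set 'rV[R]_N)
    (f : 'rV[R]_N -> R) : mpoly N R :=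
  xget 0 [set p | (msize p <= k.+1)%N /\
                  forall a, A a -> mpeval p a = f a].

Definition cube_norm (R : realType) (N : nat) (f : 'rV[R]_N -> R) : \bar R :=
  ereal_sup [set `|f x|%:E | x in @cube R N].

(* Extended-real valued, so that a finite upper bound on it is meaningful. *)
Definition lebesgue_constant (R : realType) (N : nat) (k : nat)
    (A : set 'rV[R]_N) : \bar R :=
  ereal_sup [set cube_norm (mpeval (interpolant k A f)) |
    f in [set f : 'rV[R]_N -> R |
           {within @cube R N, continuous f} /\ (cube_norm f <= 1%:E)%E]].

(* Main.v *)
(* Leja sequences of the disk have a dyadic structure: the first 2^n points are the
   2^n-th roots of unity, and the next 2^n points are the image of another Leja section
   under a rotation r with r^(2^n) = -1.  So the products of the distances from a unit
   point to the first i, and to the last 2^n - i, of 2^n Leja points are both at most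
   2^(n+1).  The real parts that are new in the block of indices [2^n, 2^(n+1)) are
   those of its first half, so that the first 2^n + 1 points of a real Leja sequence
   are the Chebyshev-Lobatto points.  Writing 2|Re z - Re w| = |z - w||z - w^*|, the
   nodal polynomial of a section of length k is bounded above by O(k^2) (after scaling
   by 2^k), and its derivative at a node is bounded below by completing the section to
   the next Chebyshev-Lobatto set and bounding the complementary product above.  Hence
   each term of the univariate Newton formula has weight O(k^4).  In several variables,
   a polynomial of degree at most k is the sum over |alpha| <= k of the products of the
   univariate Newton terms, which are at most (k+1)^(2N) in number. *)
Require Import Defs.
From HB Require Import structures.
From mathcomp Require Import all_boot all_order all_algebra all_field.
From mathcomp Require Import complex.
From mathcomp Require Import all_classical all_reals all_analysis.
From mathcomp Require Import -(notations) mpoly.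
From mathcomp Require Import zify ring lra.
Import Order.TTheory GRing.Theory Num.Theory.
Import numFieldNormedType.Exports.
Local Open Scope classical_set_scope.
Local Open Scope ring_scope.

(** * Dyadic structure of Leja sections of the disk *)

Definition leja_section {C : numClosedFieldType} (k : nat) (e : nat -> C) : Prop :=
  e 0%N = 1 /\
  forall j, (0 < j < k)%N -> `|e j| <= 1 /\
    forall z, `|z| <= 1 -> \prod_(m < j) `|z - e m| <= \prod_(m < j) `|e j - e m|.

Definition rotated_tail {C : numClosedFieldType} (n : nat) (e : nat -> C) (j : nat) : C :=
  e (2 ^ n + j)%N / e (2 ^ n)%N.

Lemma norm_opp1_sub1 {C : numClosedFieldType} : `|-1 - 1| = 2 :> C.
Proof. by rewrite -opprD normrN (normr_nat C 2). Qed.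

Lemma leja_section_le {C : numClosedFieldType} (k l : nat) (e : nat -> C) :
  (k <= l)%N -> leja_section l e -> leja_section k e.
Proof.
move=> kl [e0 eP]; split=> // j /andP[j0 jk]; apply: eP; rewrite j0.
exact: leq_trans kl.
Qed.

Lemma norm_root_of_unity {C : numClosedFieldType} (n : nat) (z : C) :
  (0 < n)%N -> `|z ^+ n| = 1 -> `|z| = 1.
Proof.
move=> n0; rewrite normrX => /eqP.
by rewrite pexpr_eq1 ?normr_ge0 -?lt0n // => /eqP.
Qed.

Lemma norm_sub_le2 {C : numClosedFieldType} (z w : C) :
  `|z| <= 1 -> `|w| <= 1 -> `|z - w| <= 2.
Proof. by move=> hz hw; rewrite (le_trans (ler_normB _ _))// (lerD hz hw). Qed.

(* Equality case of the triangle inequality [|z - 1| <= |z| + 1]. *)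
Lemma norm_sub_one_ge2_eq {C : numClosedFieldType} (z : C) :
  `|z| <= 1 -> 2 <= `|z - 1| -> z = -1.
Proof.
move=> z1 h.
have h2 : `|z - 1| ^+ 2 + `|z + 1| ^+ 2 = 2 * `|z| ^+ 2 + 2.
  by rewrite !normCK !(rmorphB, rmorphD) /= !rmorph1; ring.
have h3 : 4 <= `|z - 1| ^+ 2.
  have -> : 4 = 2 ^+ 2 :> C by ring.
  by rewrite ler_pXn2r // nnegrE ?normr_ge0 ?ler0n.
have h4 : `|z| ^+ 2 <= 1 by rewrite exprn_ile1.
have h5 : `|z + 1| ^+ 2 <= 0.
  have -> : `|z + 1| ^+ 2 = 2 * `|z| ^+ 2 + 2 - `|z - 1| ^+ 2 by rewrite -h2; ring.
  rewrite subr_le0; apply: le_trans h3.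
  have -> : 4 = 2 * 1 + 2 :> C by ring.
  by rewrite lerD2r ler_pM2l.
have : `|z + 1| ^+ 2 == 0 by rewrite eq_le h5 exprn_ge0.
by rewrite expf_eq0 /= normr_eq0 addr_eq0 => /eqP.
Qed.

Lemma prod_rotated {C : numClosedFieldType} (r : C) (u : nat -> C) (k : nat) (z : C) :
  r != 0 -> \prod_(m < k) (z - r * u m) = r ^+ k * \prod_(m < k) (z / r - u m).
Proof.
move=> r0; rewrite -[in r ^+ k](card_ord k) -prodr_const -big_split /=.
by apply: eq_bigr => m _; rewrite mulrBr mulrCA divff // mulr1.
Qed.

Lemma prod_norm_rotated {C : numClosedFieldType} (r : C) (u : nat -> C) (k : nat) (z : C) :
  `|r| = 1 -> \prod_(m < k) `|z - r * u m| = \prod_(m < k) `|z / r - u m|.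
Proof.
move=> r1; have r0 : r != 0 by rewrite -normr_eq0 r1 oner_eq0.
by rewrite -!normr_prod prod_rotated // normrM normrX r1 expr1n mul1r.
Qed.

Lemma rotated_tailK {C : numClosedFieldType} (n : nat) (e : nat -> C) (j : nat) :
  e (2 ^ n)%N != 0 -> e (2 ^ n + j)%N = e (2 ^ n)%N * rotated_tail n e j.
Proof. by move=> h; rewrite /rotated_tail mulrC divfK. Qed.

(** On the disk [|z ^+ (2 ^ n) - 1|] is at most 2, and the [2 ^ n]-th roots of -1 reach this value.
    A maximiser must therefore reach it too, which forces its power to be -1. *)
Lemma leja_block_root {C : numClosedFieldType} (n k : nat) (e : nat -> C) :
  (forall z, \prod_(m < 2 ^ n) (z - e m) = z ^+ (2 ^ n) - 1) ->
  leja_section k e -> (2 ^ n < k)%N -> e (2 ^ n)%N ^+ (2 ^ n) = -1.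
Proof.
move=> eP [_ eL] nk; have n0 : (0 < 2 ^ n)%N by rewrite expn_gt0.
have [e1 eM] := eL (2 ^ n)%N ltac:(by rewrite n0).
pose r := (2 ^ n).-root (-1 : C).
have rE : r ^+ (2 ^ n) = -1 by rewrite /r rootCK.
have r1 : `|r| = 1 by apply: (@norm_root_of_unity _ (2 ^ n)); rewrite ?rE ?normrN1.
have := eM r; rewrite r1 lexx => /(_ isT).
rewrite -!normr_prod !eP rE => h; apply: norm_sub_one_ge2_eq.
  by rewrite normrX exprn_ile1.
by apply: le_trans h; rewrite norm_opp1_sub1.
Qed.

Lemma leja_tail_prod {C : numClosedFieldType} (n i : nat) (e : nat -> C) (z : C) :
  (forall z, \prod_(m < 2 ^ n) (z - e m) = z ^+ (2 ^ n) - 1) ->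
  `|e (2 ^ n)%N| = 1 ->
  \prod_(m < 2 ^ n + i) `|z - e m| =
  `|z ^+ (2 ^ n) - 1| * \prod_(m < i) `|z / e (2 ^ n)%N - rotated_tail n e m|.
Proof.
move=> eP e1; have e0 : e (2 ^ n)%N != 0 by rewrite -normr_eq0 e1 oner_eq0.
rewrite big_split_ord /= -normr_prod eP; congr (_ * _).
rewrite -prod_norm_rotated //; apply: eq_bigr => m _ /=.
by rewrite rotated_tailK.
Qed.

Definition leja_full (C : numClosedFieldType) (n : nat) := forall e : nat -> C,
  leja_section (2 ^ n) e -> forall z, \prod_(m < 2 ^ n) (z - e m) = z ^+ (2 ^ n) - 1.

(** The maximiser is asked to be a root of unity so that, multiplied by [e (2 ^ n)], it also gives
    [|z ^+ (2 ^ n) - 1|] its maximal value 2. *)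
Definition leja_extends (C : numClosedFieldType) (n : nat) := forall (j : nat) (e : nat -> C),
  (0 < j < 2 ^ n)%N -> leja_section j e -> exists v, v ^+ (2 ^ n) = 1 /\
    forall z, `|z| <= 1 -> \prod_(m < j) `|z - e m| <= \prod_(m < j) `|v - e m|.

(* In [leja_tail_prod], the factor [|z ^+ (2 ^ n) - 1|] is at most 2, with equality at
   some maximiser of the other factor; so a maximiser of the product maximises both. *)
Lemma leja_tail_section {C : numClosedFieldType} (n i : nat) (e : nat -> C) :
  leja_full C n -> leja_extends C n -> (0 < i <= 2 ^ n)%N ->
  leja_section (2 ^ n + i) e ->
  e (2 ^ n)%N ^+ (2 ^ n) = -1 /\ leja_section i (rotated_tail n e).
Proof.
move=> hP hT /andP[i0 iN] eS; have [_ eL] := eS.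
have eP := hP e (leja_section_le _ _ _ (leq_addr _ _) eS).
have eN := leja_block_root _ _ _ eP eS ltac:(by rewrite -[X in (X < _)%N]addn0 ltn_add2l).
split=> //.
have n0 : (0 < 2 ^ n)%N by rewrite expn_gt0.
have e1 : `|e (2 ^ n)%N| = 1.
  by apply: (@norm_root_of_unity _ (2 ^ n)); rewrite ?eN ?normrN1.
have e0 : e (2 ^ n)%N != 0 by rewrite -normr_eq0 e1 oner_eq0.
elim: i {eS} i0 iN eL => // i IH _ iN eL.
have [-> | i0] := posnP i.
  by split; [rewrite /rotated_tail addn0 divff | case].
have [u0 uL] := IH i0 (ltnW iN) (fun j hj => eL j ltac:(lia)).
split=> // j /andP[j0 ji].
have [jlt | jge] := ltnP j i; first by apply: uL; rewrite j0.
have {jge ji j0 j}-> : j = i by lia.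
have [ei1 eM] := eL (2 ^ n + i)%N ltac:(lia).
have ui1 : `|rotated_tail n e i| <= 1 by rewrite normrM normfV e1 invr1 mulr1.
split=> // z z1.
have [v [vN vM]] := hT i (rotated_tail n e) ltac:(lia) (conj u0 uL).
apply: (le_trans (vM z z1)).
have v1 : `|v| = 1 by apply: (@norm_root_of_unity _ (2 ^ n)); rewrite ?vN ?normr1.
have := eM (e (2 ^ n)%N * v); rewrite normrM e1 v1 mulr1 lexx => /(_ isT).
rewrite !leja_tail_prod // exprMn eN vN mulr1 norm_opp1_sub1.
rewrite [e (2 ^ n)%N * v]mulrC mulfK // -/(rotated_tail n e i).
move=> h; rewrite -(ler_pM2l (ltr0n C 2)); apply: (le_trans h).
rewrite ler_wpM2r ?prodr_ge0 // norm_sub_le2 ?normr1 //.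
by rewrite normrX exprn_ile1.
Qed.

(** Joint induction, since [leja_tail_section] needs both properties. The two halves of a section of
    double length contribute [z ^+ (2 ^ n) - 1] and, after the rotation, [z ^+ (2 ^ n) + 1]. *)
Lemma leja_structure (C : numClosedFieldType) (n : nat) : leja_full C n /\ leja_extends C n.
Proof.
elim: n => [|n [hP hT]].
  split=> [e [e0 _] z | j e]; last by case: j => [|[]].
  by rewrite expn0 big_ord1 e0 expr1.
have n0 : (0 < 2 ^ n)%N by rewrite expn_gt0.
have dbl : (2 ^ n.+1 = 2 ^ n + 2 ^ n)%N by rewrite expnS mul2n addnn.
have sqr (z : C) : z ^+ (2 ^ n.+1) = z ^+ (2 ^ n) ^+ 2 by rewrite -exprM expnSr.
split=> [e eS z | j e /andP[j0 jN] eS].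
  rewrite dbl in eS *.
  have [eN uS] := leja_tail_section n (2 ^ n) e hP hT ltac:(by rewrite n0 leqnn) eS.
  have e0 : e (2 ^ n)%N != 0.
    by apply: contra_eq_neq eN => ->; rewrite expr0n gtn_eqF // eq_sym oppr_eq0 oner_eq0.
  rewrite big_split_ord /= (hP e (leja_section_le _ _ _ (leq_addr _ _) eS)).
  under [X in _ * X]eq_bigr do rewrite rotated_tailK //.
  rewrite prod_rotated // (hP _ uS) exprMn exprVn mulrBr mulr1 mulrCA divff ?expf_neq0 //.
  by rewrite eN exprD; ring.
have [jlt | jge] := ltnP j (2 ^ n).
  have [v [vN vM]] := hT j e ltac:(lia) eS.
  by exists v; split=> //; rewrite sqr vN expr1n.
have [jeq | jgt] : j = (2 ^ n)%N \/ (2 ^ n < j)%N by lia.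
  (* The first block is complete: any root of -1 is a maximiser, and it is a root of unity for the
     doubled exponent. *)
  pose r := (2 ^ n).-root (-1 : C).
  have rE : r ^+ (2 ^ n) = -1 by rewrite /r rootCK.
  exists r; split=> [|z z1]; first by rewrite sqr rE sqrrN expr1n.
  rewrite jeq in eS *; rewrite -!normr_prod !hP // rE norm_opp1_sub1.
  by rewrite norm_sub_le2 ?normr1 // normrX exprn_ile1.
pose i := (j - 2 ^ n)%N; have jE : j = (2 ^ n + i)%N by rewrite /i; lia.
rewrite jE in eS *.
have [eN uS] := leja_tail_section n i e hP hT ltac:(lia) eS.
have e1 : `|e (2 ^ n)%N| = 1.
  by apply: (@norm_root_of_unity _ (2 ^ n)); rewrite ?eN ?normrN1.
have e0 : e (2 ^ n)%N != 0 by rewrite -normr_eq0 e1 oner_eq0.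
have eP := hP e (leja_section_le _ _ _ (leq_addr _ _) eS).
have [v [vN vM]] := hT i _ ltac:(lia) uS.
(* A maximiser for the tail, rotated back, maximises the factor of the first block as well. *)
exists (e (2 ^ n)%N * v); split=> [|z z1].
  by rewrite sqr exprMn eN vN mulr1 sqrrN expr1n.
rewrite !leja_tail_prod // exprMn eN vN mulr1 norm_opp1_sub1.
rewrite [e (2 ^ n)%N * v]mulrC mulfK //.
apply: ler_pM; rewrite ?normr_ge0 ?prodr_ge0 //.
  by rewrite norm_sub_le2 ?normr1 // normrX exprn_ile1.
by apply: vM; rewrite normrM normfV e1 invr1 mulr1.
Qed.

Lemma leja_prod {C : numClosedFieldType} (n : nat) (e : nat -> C) (z : C) :
  leja_section (2 ^ n) e -> \prod_(m < 2 ^ n) (z - e m) = z ^+ (2 ^ n) - 1.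
Proof. by move=> eS; rewrite (proj1 (leja_structure C n)). Qed.

Lemma leja_tail {C : numClosedFieldType} (n : nat) (e : nat -> C) :
  leja_section (2 ^ n.+1) e ->
  e (2 ^ n)%N ^+ (2 ^ n) = -1 /\ leja_section (2 ^ n) (rotated_tail n e).
Proof.
have [hP hT] := leja_structure C n; move=> eS; apply: leja_tail_section => //.
  by rewrite expn_gt0 leqnn.
by rewrite addnn -mul2n -expnS.
Qed.

Lemma norm_leja_block {C : numClosedFieldType} (n : nat) (e : nat -> C) :
  leja_section (2 ^ n.+1) e -> `|e (2 ^ n)%N| = 1.
Proof.
move=> /leja_tail[eN _]; apply: (@norm_root_of_unity _ (2 ^ n)).
  by rewrite expn_gt0.
by rewrite eN normrN1.
Qed.

Lemma leja_rotated {C : numClosedFieldType} (n : nat) (e : nat -> C) (j : nat) :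
  leja_section (2 ^ n.+1) e -> e (2 ^ n + j)%N = e (2 ^ n)%N * rotated_tail n e j.
Proof.
by move=> /norm_leja_block e1; rewrite rotated_tailK // -normr_eq0 e1 oner_eq0.
Qed.

(** * Products of distances to the first and last points of a section *)

(** Each doubling costs at most a factor 2: a prefix reaching into the second half consists of the
    whole first half, with product [|z ^+ (2 ^ n) - 1|], and of a prefix of the rotated tail. *)
Lemma leja_prefix_le {C : numClosedFieldType} (n r : nat) (e : nat -> C) (z : C) :
  leja_section (2 ^ n) e -> `|z| <= 1 -> (r <= 2 ^ n)%N ->
  \prod_(m < r) `|z - e m| <= 2 ^+ n.+1.
Proof.
elim: n r e z => [|n IH] r e z eS z1 rN.
  rewrite expr1; case: r rN => [|[|//]] _.
    by rewrite big_ord0 ler1n.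
  by rewrite big_ord1 (proj1 eS) norm_sub_le2 ?normr1.
have dbl : (2 ^ n.+1 = 2 ^ n + 2 ^ n)%N by rewrite expnS mul2n addnn.
have [uN uS] := leja_tail _ _ eS; have e1 := norm_leja_block _ _ eS.
have eS' : leja_section (2 ^ n) e by apply: leja_section_le eS; rewrite dbl leq_addr.
have [rlt | rge] := leqP r (2 ^ n).
  by apply: le_trans (IH r e z eS' z1 rlt) _; rewrite ler_eXn2l ?ltr1n.
pose i := (r - 2 ^ n)%N; have -> : r = (2 ^ n + i)%N by rewrite /i; lia.
rewrite leja_tail_prod //; last by move=> w; rewrite leja_prod.
rewrite exprS ler_pM ?normr_ge0 ?prodr_ge0 //.
  by rewrite norm_sub_le2 ?normr1 // normrX exprn_ile1.
by apply: IH => //; [rewrite normrM normfV e1 invr1 mulr1 | rewrite /i; lia].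
Qed.

(** As for prefixes with the halves exchanged: a suffix starting in the first half contains the
    whole rotated tail, whose product is at most 2. *)
Lemma leja_suffix_le {C : numClosedFieldType} (n r : nat) (e : nat -> C) (z : C) :
  leja_section (2 ^ n) e -> `|z| <= 1 -> (r <= 2 ^ n)%N ->
  \prod_(r <= m < 2 ^ n) `|z - e m| <= 2 ^+ n.+1.
Proof.
elim: n r e z => [|n IH] r e z eS z1 rN.
  rewrite expr1; case: r rN => [|[|//]] _; last by rewrite big_geq // ler1n.
  by rewrite big_nat1 (proj1 eS) norm_sub_le2 ?normr1.
have dbl : (2 ^ n.+1 = 2 ^ n + 2 ^ n)%N by rewrite expnS mul2n addnn.
have [uN uS] := leja_tail _ _ eS; have e1 := norm_leja_block _ _ eS.
have eS' : leja_section (2 ^ n) e by apply: leja_section_le eS; rewrite dbl leq_addr.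
have z1' : `|z / e (2 ^ n)%N| <= 1 by rewrite normrM normfV e1 invr1 mulr1.
have shift i : (i <= 2 ^ n)%N -> \prod_(2 ^ n + i <= m < 2 ^ n.+1) `|z - e m| =
    \prod_(i <= m < 2 ^ n) `|z / e (2 ^ n)%N - rotated_tail n e m|.
  move=> iN; rewrite dbl addnC big_addn addnK; apply: eq_bigr => m _.
  rewrite addnC (leja_rotated _ _ _ eS).
  have e0 : e (2 ^ n)%N != 0 by rewrite -normr_eq0 e1 oner_eq0.
  by rewrite -{1}[z](divfK e0) [_ / _ * _]mulrC -mulrBr normrM e1 mul1r.
have [rlt | rge] := leqP r (2 ^ n).
  rewrite (@big_cat_nat _ _ _ (2 ^ n)) //=; last by rewrite dbl leq_addr.
  rewrite -{2}[(2 ^ n)%N]addn0 shift // exprS mulrC ler_pM ?prodr_ge0 //.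
    rewrite big_mkord -normr_prod leja_prod //.
    by rewrite norm_sub_le2 ?normr1 // normrX exprn_ile1.
  exact: IH.
pose i := (r - 2 ^ n)%N; have -> : r = (2 ^ n + i)%N by rewrite /i; lia.
rewrite shift; last by rewrite /i; lia.
apply: le_trans (IH i _ _ uS z1' _) _; first by rewrite /i; lia.
by rewrite ler_eXn2l ?ltr1n.
Qed.

(** * Leja points as distinct roots of unity *)

Lemma leja_unit {C : numClosedFieldType} (n : nat) (e : nat -> C) (m : nat) :
  leja_section (2 ^ n) e -> (m < 2 ^ n)%N -> e m ^+ (2 ^ n) = 1.
Proof.
move=> eS mN; apply/eqP; rewrite -subr_eq0 -(leja_prod n e) //.
by apply/prodf_eq0; exists (Ordinal mN) => //=; rewrite subrr.
Qed.

Lemma poly_ext {C : numClosedFieldType} (p q : {poly C}) :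
  (forall z, p.[z] = q.[z]) -> p = q.
Proof.
move=> pq; apply/eqP; rewrite -subr_eq0; apply/eqP.
pose rs := [seq i%:R : C | i <- iota 0 (size (p - q))].
apply: (@roots_geq_poly_eq0 _ _ rs).
- by apply/allP => z _; rewrite rootE hornerE hornerN pq subrr.
- by rewrite map_inj_uniq ?iota_uniq // => i j /eqP; rewrite eqr_nat => /eqP.
- by rewrite size_map size_iota.
Qed.

(** The points are the roots of [X ^ (2 ^ n) - 1], which is separable in characteristic 0. *)
Lemma leja_inj {C : numClosedFieldType} (n : nat) (e : nat -> C) (i j : nat) :
  leja_section (2 ^ n) e -> (i < 2 ^ n)%N -> (j < 2 ^ n)%N -> e i = e j -> i = j.
Proof.
move=> eS iN jN eij; apply/eqP; rewrite -(nth_uniq 0 (s := mkseq e (2 ^ n))) ?size_mkseq //.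
  by rewrite !nth_mkseq // eij.
have -> : mkseq e (2 ^ n) = [seq e i | i : 'I_(2 ^ n)].
  by rewrite /mkseq -val_enum_ord -map_comp.
rewrite -separable_prod_XsubC big_map big_enum /=.
have -> : \prod_(i < 2 ^ n) ('X - (e i)%:P) = 'X^(2 ^ n) - 1.
  apply: poly_ext => z; rewrite horner_prod !hornerE -(leja_prod n e) //.
  by apply: eq_bigr => m _; rewrite !hornerE.
by apply: separable_Xn_sub_1; rewrite pnatr_eq0 -lt0n expn_gt0.
Qed.

(** * Real parts of unit points, and the Leja points that bring new ones *)

(** Twice the real part, kept inside [C]; on the unit circle it is [z + z^-1], so differences factor
    algebraically. *)
Definition trace {C : numClosedFieldType} (z : C) : C := z + z^*.

Lemma conj_unit {C : numClosedFieldType} (z : C) : `|z| = 1 -> z^* = z^-1.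
Proof. by move=> z1; rewrite invC_norm z1 expr1n invr1 mul1r. Qed.

Lemma trace_sub {C : numClosedFieldType} (z w : C) : `|z| = 1 -> `|w| = 1 ->
  z * (trace z - trace w) = (z - w) * (z - w^*).
Proof.
move=> z1 w1; rewrite /trace !conj_unit //.
have z0 : z != 0 by rewrite -normr_eq0 z1 oner_eq0.
have w0 : w != 0 by rewrite -normr_eq0 w1 oner_eq0.
by field; rewrite z0 w0.
Qed.

Lemma trace_dist {C : numClosedFieldType} (z w : C) : `|z| = 1 -> `|w| = 1 ->
  `|trace z - trace w| = `|z - w| * `|z^* - w|.
Proof.
move=> z1 w1; rewrite -[LHS]mul1r -z1 -normrM trace_sub // normrM.
by rewrite -[X in _ * X]norm_conjC rmorphB /= conjCK.
Qed.

Lemma trace_inj {C : numClosedFieldType} (z w : C) : `|z| = 1 -> `|w| = 1 ->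
  trace z = trace w -> z = w \/ z = w^*.
Proof.
move=> z1 w1 tzw; have := trace_sub z w z1 w1; rewrite tzw subrr mulr0 => /esym/eqP.
by rewrite mulf_eq0 !subr_eq0 => /orP[] /eqP; [left | right].
Qed.

(* As [c] is [i] or [-i], the other half of the block, where [z ^+ (2 ^ n) = - c],
   is the conjugate of this one: only the first half yields new real parts. *)
Lemma leja_half_block {C : numClosedFieldType} (n : nat) (e : nat -> C) :
  leja_section (2 ^ n.+2) e -> exists c : C,
  [/\ c ^+ 2 = -1, c^* = - c &
   forall z, \prod_(j < 2 ^ n) (z - e (2 ^ n.+1 + j)%N) = z ^+ (2 ^ n) - c].
Proof.
move=> eS; have [eN uS] := leja_tail _ _ eS; have e1 := norm_leja_block _ _ eS.
have e0 : e (2 ^ n.+1)%N != 0 by rewrite -normr_eq0 e1 oner_eq0.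
have uS' : leja_section (2 ^ n) (rotated_tail n.+1 e).
  by apply: leja_section_le uS; rewrite leq_exp2l.
pose c := e (2 ^ n.+1)%N ^+ (2 ^ n).
have c2 : c ^+ 2 = -1 by rewrite -exprM -expnSr.
have c0 : c != 0 by rewrite expf_neq0.
exists c; split=> //.
  rewrite conj_unit ?normrX ?e1 ?expr1n //; apply: (mulfI c0).
  by rewrite divff // mulrN -expr2 c2 opprK.
move=> z; under eq_bigr do rewrite (leja_rotated _ _ _ eS).
rewrite prod_rotated // leja_prod // exprMn exprVn mulrBr mulr1 mulrCA divff ?mulr1 //.
Qed.

Lemma norm_leja {C : numClosedFieldType} (e : nat -> C) (m : nat) :
  (forall k, leja_section k e) -> `|e m| = 1.
Proof.
move=> eL; apply: (@norm_root_of_unity _ (2 ^ m)); first by rewrite expn_gt0.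
by rewrite leja_unit ?normr1 // ltn_expl.
Qed.

Lemma leja_half_block_root {C : numClosedFieldType} (n j : nat) (e : nat -> C) (c : C) :
  (forall z, \prod_(j < 2 ^ n) (z - e (2 ^ n.+1 + j)%N) = z ^+ (2 ^ n) - c) ->
  (j < 2 ^ n)%N -> e (2 ^ n.+1 + j)%N ^+ (2 ^ n) = c.
Proof.
move=> cP jN; apply/eqP; rewrite -subr_eq0 -cP.
by apply/prodf_eq0; exists (Ordinal jN) => //=; rewrite subrr.
Qed.

(** With equal traces, [e m] is the given point or its conjugate, so its [2 ^ n]-th power is [c] or
    [- c], of square -1. This excludes the indices below [2 ^ n.+1], where the square is 1. Within
    the same half block the points are distinct, and all have power [c], whereas the conjugate has
    power [- c]. *)
Lemma leja_first_half_new {C : numClosedFieldType} (e : nat -> C) (n j m : nat) :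
  (forall k, leja_section k e) -> (j < 2 ^ n)%N -> (m < 2 ^ n.+1 + j)%N ->
  trace (e m) <> trace (e (2 ^ n.+1 + j)%N).
Proof.
move=> eL jN mlt /(trace_inj _ _ (norm_leja _ _ eL) (norm_leja _ _ eL)) em.
have [c [c2 cJ cP]] := leja_half_block n e (eL _).
have ej := leja_half_block_root _ _ _ _ cP jN.
have em_c : e m ^+ (2 ^ n) = c \/ e m ^+ (2 ^ n) = - c.
  by case: em => ->; rewrite -?rmorphXn /= ej ?cJ; [left | right].
have ltN : (2 ^ n < 2 ^ n.+1)%N by rewrite ltn_exp2l.
have dbl : (2 ^ n.+2 = 2 ^ n.+1 + 2 ^ n.+1)%N by rewrite expnS mul2n addnn.
have n11 : (1 : C) <> -1.
  by move/eqP; rewrite -subr_eq0 opprK (pnatr_eq0 C 2).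
have [mlo | mhi] := ltnP m (2 ^ n.+1).
  have := leja_unit _ _ _ (eL (2 ^ n.+1)%N) mlo.
  rewrite expnSr exprM; case: em_c => ->; rewrite ?sqrrN c2 => /esym; exact: n11.
have mE : m = (2 ^ n.+1 + (m - 2 ^ n.+1))%N by lia.
case: em => [/(leja_inj n.+2 _ _ _ (eL _)) | em]; first by lia.
have := leja_half_block_root _ (m - 2 ^ n.+1)%N _ _ cP ltac:(lia).
rewrite -mE em -rmorphXn /= ej cJ => /eqP.
rewrite eq_sym -subr_eq0 opprK -mulr2n mulrn_eq0 /= => /eqP c0.
by move: c2; rewrite c0 expr0n => /eqP; rewrite eq_sym oppr_eq0 oner_eq0.
Qed.

(** The first half already exhausts the roots of [z ^+ (2 ^ n) = c], so a point of the second half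
    has power [- c]; its conjugate has power [c] and hence lies in the first half. *)
Lemma leja_second_half_old {C : numClosedFieldType} (e : nat -> C) (n j : nat) :
  (forall k, leja_section k e) -> (2 ^ n <= j < 2 ^ n.+1)%N ->
  exists2 m, (m < 2 ^ n.+1 + j)%N & trace (e m) = trace (e (2 ^ n.+1 + j)%N).
Proof.
move=> eL /andP[jlo jhi].
have [c [c2 cJ cP]] := leja_half_block n e (eL _).
have dbl : (2 ^ n.+2 = 2 ^ n.+1 + 2 ^ n.+1)%N by rewrite expnS mul2n addnn.
have [eN uS] := leja_tail n.+1 e (eL _).
have root_c z : z ^+ (2 ^ n) = c -> exists2 j', (j' < 2 ^ n)%N & z = e (2 ^ n.+1 + j')%N.
  move=> /eqP; rewrite -subr_eq0 -cP => /prodf_eq0[j' _].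
  by rewrite subr_eq0 => /eqP ->; exists j'.
have /eqP : (e (2 ^ n.+1 + j)%N ^+ (2 ^ n)) ^+ 2 = c ^+ 2.
  rewrite -exprM -expnSr (leja_rotated _ _ _ (eL _)) exprMn eN.
  by rewrite (leja_unit _ _ _ uS) // mulr1 c2.
rewrite eqf_sqr => /orP[] /eqP ec.
  have [j' j'N /(leja_inj n.+2 _ _ _ (eL _))] := root_c _ ec; lia.
have [|j' j'N ej] := root_c (e (2 ^ n.+1 + j)%N)^*.
  by rewrite -rmorphXn /= ec rmorphN /= cJ opprK.
by exists (2 ^ n.+1 + j')%N; [lia | rewrite -ej /trace conjCK addrC].
Qed.

(** * First occurrences of the real parts *)

Lemma increasing_next (P : nat -> Prop) (phi : nat -> nat) (k a b : nat) :
  {homo phi : m n / (m < n)%N} -> (forall k, P (phi k)) ->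
  (forall n, P n -> exists k, phi k = n) ->
  phi k = a -> (a < b)%N -> P b -> (forall m, (a < m < b)%N -> ~ P m) -> phi k.+1 = b.
Proof.
move=> phiI phiP phiS phik ab Pb Pab; have [k' k'E] := phiS b Pb.
have [k'lt | kk' |k'eq] := ltngtP k' k.+1; last by rewrite -k'eq.
  have : (phi k' <= phi k)%N.
    by move: k'lt; rewrite ltnS leq_eqVlt => /predU1P[-> //|/phiI /ltnW].
  lia.
have h1 := phiI _ _ kk'; have h2 := phiI _ _ (ltnSn k).
by case: (Pab (phi k.+1)); [lia | ].
Qed.

(** Besides 1 and -1, the first halves of the blocks [[2 ^ n.+1, 2 ^ n.+2)] are kept, put end to
    end: these are the unit points above the real Leja points. *)
Definition leja_projection {C : numClosedFieldType} (e y : nat -> C) : Prop :=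
  [/\ y 0%N = 1, y 1%N = -1 &
      forall n j, (j < 2 ^ n)%N -> y (2 ^ n + 1 + j)%N = e (2 ^ n.+1 + j)%N].

(** The enumeration [phi] goes through the first half of a block index by index, as all of it is
    new, then jumps over the second half, as all of it is old. *)
Lemma first_occurrences_projection {C : numClosedFieldType} (e : nat -> C) (phi : nat -> nat) :
  (forall k, leja_section k e) -> {homo phi : m n / (m < n)%N} ->
  (forall k m, (m < phi k)%N -> trace (e m) <> trace (e (phi k))) ->
  (forall n, (forall m, (m < n)%N -> trace (e m) <> trace (e n)) -> exists k, phi k = n) ->
  leja_projection e (e \o phi).
Proof.
move=> eL phiI phiP phiS.
pose P n := forall m, (m < n)%N -> trace (e m) <> trace (e n).
have next k a b := @increasing_next P phi k a b phiI phiP phiS.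
have e0 : e 0%N = 1 by case: (eL 0%N).
have e1 : e 1%N = -1 by have [/= + _] := leja_tail 0 e (eL _); rewrite expr1.
have p0 : phi 0%N = 0%N.
  have [k kE] := phiS 0%N ltac:(by []).
  by case: k kE => // k kE; have := phiI _ _ (ltn0Sn k); rewrite kE.
have p1 : phi 1%N = 1%N.
  apply: (next 0%N 0%N) => // [|m]; last by lia.
  case=> // _; rewrite e0 e1 /trace rmorphN !rmorph1 => /eqP.
  rewrite -subr_eq0. have -> : 1 + 1 - (-1 - 1) = 4%:R :> C by ring.
  by rewrite pnatr_eq0.
have blk n j : (j < 2 ^ n)%N -> phi (2 ^ n + 1)%N = (2 ^ n.+1)%N ->
    phi (2 ^ n + 1 + j)%N = (2 ^ n.+1 + j)%N.
  move=> + pn; elim: j => [|j IH] jN; first by rewrite !addn0.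
  rewrite !(addnS _ j); apply: (next _ _ _ (IH (ltnW jN))) => [//|m|m]; last by lia.
  by rewrite -addnS; apply: leja_first_half_new.
suff pn n : phi (2 ^ n + 1)%N = (2 ^ n.+1)%N.
  by split; rewrite /= ?p0 ?p1 ?e0 ?e1 // => n j jN; rewrite blk.
elim: n => [|n IH].
  apply: (next 1%N 1%N) => // [m m2|m]; last by lia.
  by apply: (leja_first_half_new e 0 0 m eL).
have n0 : (0 < 2 ^ n)%N by rewrite expn_gt0.
have dbl m : (2 ^ m.+1 = 2 ^ m + 2 ^ m)%N by rewrite expnS mul2n addnn.
(* The jump starts at the last index of the first half. *)
have last_ := blk n (2 ^ n).-1 ltac:(lia) IH.
have -> : (2 ^ n.+1 + 1 = (2 ^ n + 1 + (2 ^ n).-1).+1)%N by rewrite dbl; lia.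
apply: (next _ _ _ last_) => [|m mlt|m mlt Pm].
- by rewrite [in X in (_ < X)%N]dbl [in X in (_ < X)%N]dbl dbl; lia.
- by have := leja_first_half_new e n.+1 0 m eL; rewrite addn0; apply; rewrite ?expn_gt0.
- have := leja_second_half_old e n (m - 2 ^ n.+1) eL.
  have d1 := dbl n; have d2 := dbl n.+1.
  case=> [|m']; first by lia.
  have -> : (2 ^ n.+1 + (m - 2 ^ n.+1) = m)%N by lia.
  exact: Pm.
Qed.

(** * Factorisation over the Chebyshev-Lobatto points *)

(** The points of the half block give [z ^+ (2 ^ n) - c], their conjugates [z ^+ (2 ^ n) + c], and
    [c ^+ 2 = -1]. *)
Lemma projection_factor {C : numClosedFieldType} (e y : nat -> C) (n : nat) :
  (forall k, leja_section k e) -> leja_projection e y ->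
  forall z, \prod_(j < 2 ^ n) ((z - y (2 ^ n + 1 + j)%N) * (z - (y (2 ^ n + 1 + j)%N)^*)) =
            z ^+ (2 ^ n.+1) + 1.
Proof.
move=> eL [_ _ yB] z; have [c [c2 cJ cP]] := leja_half_block n e (eL _).
rewrite big_split /= (eq_bigr (fun j : 'I__ => z - e (2 ^ n.+1 + j)%N)); last first.
  by move=> j _; rewrite yB.
rewrite [X in _ * X](eq_bigr (fun j : 'I__ => (z^* - e (2 ^ n.+1 + j)%N)^*)); last first.
  by move=> j _; rewrite (yB _ _ (ltn_ord j)) rmorphB /= conjCK.
rewrite -rmorph_prod !cP rmorphB rmorphXn /= conjCK cJ opprK -subr_sqr c2 opprK.
by rewrite -exprM -expnSr.
Qed.

(** The endpoints 1 and -1 are their own conjugates and count twice, whence the factor [z ^+ 2 - 1].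
    Each further block multiplies [z ^+ M - 1] by [z ^+ M + 1]. *)
Lemma lobatto_prod {C : numClosedFieldType} (e y : nat -> C) (n : nat) :
  (forall k, leja_section k e) -> leja_projection e y ->
  forall z, \prod_(m < 2 ^ n + 1) ((z - y m) * (z - (y m)^*)) =
            (z ^+ 2 - 1) * (z ^+ (2 ^ n.+1) - 1).
Proof.
move=> eL yP z; elim: n => [|n IH].
  have [y0 y1 _] := yP; rewrite !big_ord_recl big_ord0 /= y0 y1 rmorphN !rmorph1.
  by rewrite expn1; ring.
have -> : (2 ^ n.+1 + 1 = 2 ^ n + 1 + 2 ^ n)%N by rewrite expnS; lia.
rewrite big_split_ord /= IH (projection_factor e) // -mulrA -subr_sqr expr1n -exprM.
by rewrite -expnSr.
Qed.

Lemma norm_projection {C : numClosedFieldType} (e y : nat -> C) (m : nat) :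
  (forall k, leja_section k e) -> leja_projection e y -> `|y m| = 1.
Proof.
move=> eL [y0 y1 yB]; case: m => [|[|m]]; rewrite ?y0 ?y1 ?normrN ?normr1 //.
have [h1 h2] := andP (trunc_log_bounds (isT : 1 < 2)%N (ltn0Sn m)).
set n := trunc_log 2 m.+1 in h1 h2.
have -> : m.+2 = (2 ^ n + 1 + (m.+1 - 2 ^ n))%N by lia.
by rewrite yB ?norm_leja //; rewrite expnS in h2; lia.
Qed.

(** * Bounds for the nodal polynomial and its derivative at the nodes *)

Lemma norm_conj_unit {C : numClosedFieldType} (z : C) : `|z| = 1 -> `|z^*| <= 1.
Proof. by rewrite norm_conjC => ->. Qed.

Lemma leja_block_half_section {C : numClosedFieldType} (e : nat -> C) (n : nat) :
  (forall k, leja_section k e) -> leja_section (2 ^ n) (rotated_tail n.+1 e).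
Proof.
move=> eL; apply: leja_section_le (proj2 (leja_tail n.+1 e (eL _))).
by rewrite leq_exp2l.
Qed.

(** Brings the distances back to a Leja section, seen from [z] and from its conjugate, so that the
    prefix and suffix bounds apply to each factor. *)
Lemma projection_dist {C : numClosedFieldType} (e y : nat -> C) (z : C) (n j : nat) :
  (forall k, leja_section k e) -> leja_projection e y -> `|z| = 1 -> (j < 2 ^ n)%N ->
  `|trace z - trace (y (2 ^ n + 1 + j)%N)| =
  `|z / e (2 ^ n.+1)%N - rotated_tail n.+1 e j| *
  `|z^* / e (2 ^ n.+1)%N - rotated_tail n.+1 e j|.
Proof.
move=> eL yP z1 jN; have [_ _ yB] := yP.
have e1 := norm_leja_block _ _ (eL (2 ^ n.+2)%N).
have e0 : e (2 ^ n.+1)%N != 0 by rewrite -normr_eq0 e1 oner_eq0.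
have tail_dist w : `|w - y (2 ^ n + 1 + j)%N| =
    `|w / e (2 ^ n.+1)%N - rotated_tail n.+1 e j|.
  rewrite yB // (leja_rotated _ _ _ (eL _)) -{1}[w](divfK e0).
  by rewrite [_ / _ * _]mulrC -mulrBr normrM e1 mul1r.
by rewrite trace_dist ?(norm_projection e y) // !tail_dist.
Qed.

Lemma norm_div_leja_le1 {C : numClosedFieldType} (e : nat -> C) (z : C) (n : nat) :
  (forall k, leja_section k e) -> `|z| <= 1 -> `|z / e n| <= 1.
Proof. by move=> eL z1; rewrite normrM normfV (norm_leja e n eL) invr1 mulr1. Qed.

Lemma lobatto_norm_prod {C : numClosedFieldType} (e y : nat -> C) (z : C) (n : nat) :
  (forall k, leja_section k e) -> leja_projection e y -> `|z| = 1 ->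
  \prod_(m < 2 ^ n + 1) `|trace z - trace (y m)| =
  `|z ^+ 2 - 1| * `|z ^+ (2 ^ n.+1) - 1|.
Proof.
move=> eL yP z1; rewrite -normrM -(lobatto_prod e y n eL yP) normr_prod.
apply: eq_bigr => m _.
by rewrite -trace_sub ?(norm_projection e y) // normrM z1 mul1r.
Qed.

(** The largest Lobatto set contained in the section contributes at most [2 * 2]; the remaining
    points form a prefix of a half block, bounded by [2 ^+ n.+1] from [z] and again from its
    conjugate. *)
Lemma projection_prod_le {C : numClosedFieldType} (e y : nat -> C) (z : C) (k : nat) :
  (forall k, leja_section k e) -> leja_projection e y -> `|z| = 1 ->
  \prod_(m < k) `|trace z - trace (y m)| <= 16%:R * k.+1%:R ^+ 2.
Proof.
move=> eL yP z1.
have le1 (l : nat) : 1 <= (l.+1%:R : C) ^+ 2 by rewrite exprn_ege1 // ler1n.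
case: k => [|[|k]].
- rewrite big_ord0; apply: (@le_trans _ _ 16%:R); first by rewrite ler1n.
  by rewrite ler_peMr ?ler0n.
- rewrite big_ord1 trace_dist ?(norm_projection e y) //.
  apply: (@le_trans _ _ (2 * 2)).
    by rewrite ler_pM ?normr_ge0 // norm_sub_le2 ?norm_conjC ?z1 ?(norm_projection e y).
  by rewrite -natrX -!natrM ler_nat.
have [h1 h2] := andP (trunc_log_bounds (isT : 1 < 2)%N (ltn0Sn k)).
set n := trunc_log 2 k.+1 in h1 h2.
(* The first [2 ^ n + 1] points are the Lobatto set, and [i < 2 ^ n] points of the next block
   remain. *)
pose i := (k.+1 - 2 ^ n)%N; rewrite expnS in h2.
have -> : k.+2 = (2 ^ n + 1 + i)%N by rewrite /i; lia.
rewrite big_split_ord /= (lobatto_norm_prod e) //.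
under [X in _ * X]eq_bigr => j _.
  rewrite (projection_dist e) //; last by have := ltn_ord j; rewrite {2}/i; lia.
  over.
rewrite big_split /=.
have pre w : `|w| <= 1 -> \prod_(j < i) `|w / e (2 ^ n.+1)%N - rotated_tail n.+1 e j| <= 2 ^+ n.+1.
  move=> w1; apply: leja_prefix_le; last by rewrite /i; lia.
    exact: leja_block_half_section.
  exact: norm_div_leja_le1.
apply: (@le_trans _ _ ((2 * 2) * (2 ^+ n.+1 * 2 ^+ n.+1))).
  apply: ler_pM; rewrite ?mulr_ge0 ?normr_ge0 ?prodr_ge0 //.
    by rewrite ler_pM ?normr_ge0 // norm_sub_le2 ?normr1 // normrX z1 expr1n.
  by apply: ler_pM; rewrite ?prodr_ge0 // pre ?norm_conj_unit // z1.
rewrite -natrX -!natrM -natrX -natrM ler_nat expnS.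
by have : (2 ^ n <= k.+1)%N by []; rewrite /i; nia.
Qed.

(* Cancel [X - a] from the factorisation [lobatto_prod]: the cofactor of
   [X ^ M - a ^ M] takes the value [M a ^ (M - 1)] at [a]. *)
Lemma lobatto_derivative_ge1 {C : numClosedFieldType} (e y : nat -> C) (n j : nat) :
  (forall k, leja_section k e) -> leja_projection e y -> (j < 2 ^ n + 1)%N ->
  1 <= \prod_(m < 2 ^ n + 1 | m != j :> nat) `|trace (y j) - trace (y m)|.
Proof.
move=> eL yP jN; pose a := y j.
have a1 : `|a| = 1 by rewrite (norm_projection e y).
have a0 : a != 0 by rewrite -normr_eq0 a1 oner_eq0.
pose M := (2 ^ n.+1)%N.
have M0 : (0 < M)%N by rewrite expn_gt0.
have MR : 1 <= `|M%:R * a ^+ M.-1|.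
  by rewrite normrM normrX a1 expr1n mulr1 normr_nat ler1n.
have jP (F : 'I_(2 ^ n + 1) -> C) : \prod_(m < 2 ^ n + 1) F m =
    F (Ordinal jN) * \prod_(m < 2 ^ n + 1 | m != j :> nat) F m.
  by rewrite (bigD1 (Ordinal jN)).
have aM : a ^+ M = 1.
  have := lobatto_prod e y n eL yP a.
  rewrite jP /= subrr !mul0r => /esym/eqP.
  rewrite mulf_eq0 !subr_eq0 => /orP[] /eqP // a2.
  by rewrite /M expnS exprM a2 expr1n.
pose A : {poly C} := \prod_(m < 2 ^ n + 1 | m != j :> nat) (('X - (y m)%:P) * ('X - (y m)^*%:P)).
pose S : {poly C} := \sum_(i < M) 'X ^+ (M.-1 - i) * a%:P ^+ i.
have Sa : S.[a] = M%:R * a ^+ M.-1.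
  rewrite horner_sum (eq_bigr (fun=> a ^+ M.-1)).
    by rewrite sumr_const card_ord mulr_natl.
  move=> i _; rewrite !hornerE -exprD; congr (_ ^+ _).
  by rewrite subnK // -ltnS prednK.
have AS : ('X - a^*%:P) * A = ('X^2 - 1) * S.
  apply: (@mulfI _ ('X - a%:P)); first by rewrite polyXsubC_eq0.
  rewrite [RHS]mulrCA /S -subrXX; apply: poly_ext => z; rewrite !hornerE aM.
  rewrite -(lobatto_prod e y n eL yP) jP -/a; congr (_ * _).
  by rewrite horner_prod; apply: eq_bigr => m _; rewrite !hornerE.
have Aa : \prod_(m < 2 ^ n + 1 | m != j :> nat) `|trace (y j) - trace (y m)| = `|A.[a]|.
  rewrite horner_prod normr_prod; apply: eq_bigr => m _; rewrite !hornerE.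
  by rewrite -trace_sub ?(norm_projection e y) // normrM a1 mul1r.
rewrite Aa.
(* An endpoint 1 or -1 is its own conjugate: one more factor [X - a] cancels and leaves [X + a], of
   value [a + a]. *)
have [a2 | a2] := eqVneq (a ^+ 2) 1.
  have aJ : a^* = a by rewrite conj_unit //; apply: (mulfI a0); rewrite divff // -expr2.
  have {}AS : A = ('X + a%:P) * S.
    apply: (@mulfI _ ('X - a%:P)); first by rewrite polyXsubC_eq0.
    by rewrite -{1}aJ AS mulrA -subr_sqr -rmorphXn /= a2.
  have a21 : 1 <= `|a + a| by rewrite -mulr2n normrMn a1 ler1n.
  by rewrite AS hornerM hornerD hornerX hornerC Sa normrM; apply: mulr_ege1.
(* At an interior node, multiplying by [a] turns the difference of [a] and its conjugate into
   [a ^+ 2 - 1], which cancels on both sides. *)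
have := congr1 (fun p => `|a * p.[a]|) AS.
rewrite !hornerM hornerXsubC Sa hornerD hornerN hornerXn hornerC.
rewrite mulrA mulrBr conj_unit // divff // -expr2 normrM [RHS]normrM a1 mul1r.
rewrite [RHS]normrM => /(mulfI _) ->; first exact: MR.
by rewrite normr_eq0 subr_eq0.
Qed.

(** Over the next Lobatto set, of [2 ^ n.+1 + 1] points, the product is at least 1. The points added
    to reach it form a suffix of a half block, so their product is at most
    [2 ^+ n.+1 * 2 ^+ n.+1]. *)
Lemma projection_derivative_ge {C : numClosedFieldType} (e y : nat -> C) (j k : nat) :
  (forall k, leja_section k e) -> leja_projection e y -> (j <= k)%N ->
  1 <= 4%:R * k.+1%:R ^+ 2 * \prod_(m < k.+1 | m != j :> nat) `|trace (y j) - trace (y m)|.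
Proof.
move=> eL yP; case: k => [|k] jk.
  have -> : j = 0%N by lia.
  by rewrite big_pred0 ?expr1n ?mulr1 ?ler1n // => -[[|//] ?].
have [h1 h2] := andP (trunc_log_bounds (isT : 1 < 2)%N (ltn0Sn k)).
set n := trunc_log 2 k.+1 in h1 h2.
have dbl : (2 ^ n.+1 = 2 ^ n + 2 ^ n)%N by rewrite expnS mul2n addnn.
pose i := (k.+1 - 2 ^ n)%N.
pose F m := `|trace (y j) - trace (y m)|.
have full := lobatto_derivative_ge1 e y n.+1 j eL yP ltac:(lia).
have split_ : \prod_(m < 2 ^ n.+1 + 1 | m != j :> nat) F m =
    \prod_(m < k.+2 | m != j :> nat) F m * \prod_(i <= m < 2 ^ n) F (2 ^ n + 1 + m)%N.
  rewrite -!(big_mkord (fun m => m != j)) (@big_cat_nat _ _ _ k.+2) //=; last by lia.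
  congr (_ * _).
  have -> : k.+2 = (i + (2 ^ n + 1))%N by rewrite /i; lia.
  have -> : (2 ^ n.+1 + 1 = 2 ^ n + (2 ^ n + 1))%N by lia.
  rewrite big_addn addnK big_nat_cond [RHS]big_nat_cond.
  apply: eq_big => m; last by rewrite addnC.
  by rewrite /i; lia.
apply: le_trans full _; rewrite split_ mulrC ler_wpM2r //.
  by rewrite prodr_ge0 // => m _; rewrite normr_ge0.
rewrite (eq_big_nat _ _ (F2 := fun m =>
  `|y j / e (2 ^ n.+1)%N - rotated_tail n.+1 e m| *
  `|(y j)^* / e (2 ^ n.+1)%N - rotated_tail n.+1 e m|)); last first.
  by move=> m /andP[_ mN]; rewrite /F (projection_dist e) // (norm_projection e y).
rewrite big_split /=.
have suf w : `|w| <= 1 ->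
    \prod_(i <= m < 2 ^ n) `|w / e (2 ^ n.+1)%N - rotated_tail n.+1 e m| <= 2 ^+ n.+1.
  move=> w1; apply: leja_suffix_le; last by rewrite /i; lia.
    exact: leja_block_half_section.
  exact: norm_div_leja_le1.
apply: (@le_trans _ _ (2 ^+ n.+1 * 2 ^+ n.+1)).
  apply: ler_pM; rewrite ?prodr_ge0 // suf ?norm_conj_unit // (norm_projection e y) //.
rewrite -!natrX -!natrM ler_nat expnS.
by have : (2 ^ n <= k.+1)%N by []; nia.
Qed.

(** * Newton interpolation in one variable *)

Definition newton_poly {K : fieldType} (x : nat -> K) (a : nat) (t : K) : K :=
  \prod_(m < a) (t - x m).

(* The coefficient of [p.[x b]] in the divided difference of [p] at [x 0, ..., x a]. *)
Definition newton_weight {K : fieldType} (x : nat -> K) (a b : nat) : K :=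
  if (b <= a)%N then (\prod_(m < a.+1 | m != b :> nat) (x b - x m))^-1 else 0.

(** By Lagrange interpolation at [x 0, ..., x a]: each basis polynomial is a monic product of degree
    [a] divided by its value at the node. In particular, divided differences of order above the
    degree vanish. *)
Lemma divided_difference_coef {K : fieldType} (x : nat -> K) (k a : nat) (p : {poly K}) :
  injective x -> (a <= k)%N -> (size p <= a.+1)%N ->
  \sum_(b < k.+1) p.[x b] * newton_weight x a b = p`_a.
Proof.
move=> xI ak sp.
have -> : \sum_(b < k.+1) p.[x b] * newton_weight x a b =
    \sum_(b < a.+1) p.[x b] * newton_weight x a b.
  rewrite [RHS](big_ord_widen k.+1 (fun b => p.[x b] * newton_weight x a b)) //.
  rewrite [RHS]big_mkcond; apply: eq_bigr => b _.
  by rewrite /newton_weight ltnS; case: leqP => //; rewrite mulr0.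
rewrite [in RHS](lagrange_gen _ xI sp) // coef_sum; apply: eq_bigr => b _.
rewrite coefCM lagrangeE //= coefCM; congr (_ * _).
rewrite /newton_weight -ltnS ltn_ord horner_prod.
under [in RHS]eq_bigr do rewrite hornerXsubC.
suff -> : (\prod_(j < a.+1 | j != b) ('X - (x j)%:P))`_a = 1 by rewrite mulr1.
have sz : size [seq j <- index_enum 'I_a.+1 | j != b] = a.
  rewrite -sum1_size big_filter (eq_bigl (fun j => j \in predC1 b)) //.
  by rewrite sum1_card cardC1 card_ord.
have := lead_coef_prod_XsubC (index_enum 'I_a.+1) (fun j => j != b) (fun j => x j).
by rewrite lead_coefE -big_filter size_prod_XsubC sz.
Qed.

(** Induction on the size: the top term is a multiple of the monic nodal polynomial [w]. As [w]
    vanishes at the nodes entering the divided differences of lower order, removing it leaves them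
    unchanged. *)
Lemma newton_interpolation {K : fieldType} (x : nat -> K) (k : nat) (p : {poly K}) (t : K) :
  injective x -> (size p <= k.+1)%N ->
  p.[t] = \sum_(a < k.+1) (\sum_(b < k.+1) p.[x b] * newton_weight x a b) * newton_poly x a t.
Proof.
move=> xI sp.
suff main n : (n <= k.+1)%N -> forall q : {poly K}, (size q <= n)%N ->
    q.[t] = \sum_(a < n) (\sum_(b < k.+1) q.[x b] * newton_weight x a b) * newton_poly x a t.
  exact: main.
elim: n => [|n IH] nk q sq.
  by move: sq; rewrite leqn0 size_poly_eq0 => /eqP ->; rewrite horner0 big_ord0.
pose w := \prod_(m < n) ('X - (x m)%:P).
have sw : size w = n.+1.
  by rewrite /w size_prod_XsubC -sum1_size (eq_bigl (fun m => m \in predT)) // sum1_card card_ord.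
have wn : w`_n = 1.
  by have := lead_coef_prod_XsubC (index_enum 'I_n) xpredT (fun m => x m);
    rewrite lead_coefE -/w sw.
have wE s : w.[s] = newton_poly x n s.
  by rewrite horner_prod; apply: eq_bigr => m _; rewrite hornerXsubC.
pose r := q - q`_n *: w.
have sr : (size r <= n)%N.
  apply/leq_sizeP => j; rewrite leq_eqVlt => /predU1P[<-|nj].
    by rewrite coefB coefZ wn mulr1 subrr.
  have qj : q`_j = 0 by apply: nth_default; exact: leq_trans sq nj.
  have wj : w`_j = 0 by apply: nth_default; rewrite sw.
  by rewrite coefB coefZ qj wj mulr0 subr0.
rewrite big_ord_recr /= (divided_difference_coef _ _ _ _ xI _ sq) //.
have -> : q.[t] = r.[t] + q`_n * newton_poly x n t.
  by rewrite /r hornerD hornerN hornerZ wE subrK.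
congr (_ + _); rewrite (IH (ltnW nk) r sr); apply: eq_bigr => a _.
congr (_ * _); apply: eq_bigr => b _.
have [ba | ba] := leqP b a; last by rewrite /newton_weight leqNgt ba /= !mulr0.
congr (_ * _); rewrite /r hornerD hornerN hornerZ wE.
have -> : newton_poly x n (x b) = 0.
  apply/eqP/prodf_eq0; exists (Ordinal (leq_ltn_trans ba (ltn_ord a))) => //=.
  by rewrite subrr.
by rewrite mulr0 subr0.
Qed.

(** * Newton interpolation in several variables *)

Definition grid_point {R : realType} {N k : nat} (X : 'I_N -> nat -> R)
    (beta : {ffun 'I_N -> 'I_k.+1}) : 'rV[R]_N := \row_j X j (beta j).

(** By linearity it is enough to treat monomials, whose value is a product of univariate Newton
    expansions; expanding this product gives a sum over all [alpha] and [beta]. *)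
Lemma mpeval_newton {R : realType} {N k : nat} (X : 'I_N -> nat -> R) (p : mpoly N R)
    (x : 'rV[R]_N) :
  (forall j, injective (X j)) -> (msize p <= k.+1)%N ->
  mpeval p x = \sum_(alpha : {ffun 'I_N -> 'I_k.+1} | (\sum_j alpha j <= k)%N)
    \sum_(beta : {ffun 'I_N -> 'I_k.+1}) mpeval p (grid_point X beta) *
      \prod_j (newton_weight (X j) (alpha j) (beta j) * newton_poly (X j) (alpha j) (x 0 j)).
Proof.
move=> XI sp.
pose W (alpha beta : {ffun 'I_N -> 'I_k.+1}) :=
  \prod_j (newton_weight (X j) (alpha j) (beta j) * newton_poly (X j) (alpha j) (x 0 j)).
have monomial (g : 'I_N -> nat) : (\sum_j g j <= k)%N ->
    \prod_j x 0 j ^+ g j = \sum_(alpha : {ffun 'I_N -> 'I_k.+1} | (\sum_j alpha j <= k)%N)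
      \sum_(beta : {ffun 'I_N -> 'I_k.+1}) (\prod_j X j (beta j) ^+ g j) * W alpha beta.
  move=> gk.
  have gjk j : (g j <= k)%N by apply: leq_trans gk; rewrite (bigD1 j) //= leq_addr.
  pose T j (a : 'I_k.+1) :=
    (\sum_(b < k.+1) X j b ^+ g j * newton_weight (X j) a b) * newton_poly (X j) a (x 0 j).
  have TE j : x 0 j ^+ g j = \sum_(a < k.+1) T j a.
    rewrite -hornerXn (newton_interpolation (X j) k) ?size_polyXn ?ltnS //.
    by apply: eq_bigr => a _; congr (_ * _); apply: eq_bigr => b _; rewrite hornerXn.
  (* A divided difference of order above the degree is zero. *)
  have T0 : forall j (a : 'I_k.+1), (g j < a)%N -> T j a = 0.
    move=> i a ga; have := divided_difference_coef (X i) k a ('X^(g i)) (XI i) ltac:(by rewrite -ltnS).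
    rewrite size_polyXn ltnS => /(_ (ltnW ga)).
    rewrite coefXn gtn_eqF //= /T => E.
    rewrite (_ : \sum_(b < k.+1) _ = 0) ?mul0r // -[RHS]E.
    by apply: eq_bigr => b _; rewrite hornerXn.
  have -> : \prod_j x 0 j ^+ g j = \prod_j \sum_(a < k.+1) T j a by apply: eq_bigr.
  rewrite bigA_distr_bigA /=.
  rewrite (bigID (fun alpha : {ffun 'I_N -> 'I_k.+1} => (\sum_j alpha j <= k)%N)) /=.
  (* If [alpha] has sum above [k], some [alpha j] exceeds [g j], and the corresponding factor
     vanishes. *)
  rewrite [X in _ + X]big1 ?addr0 => [|alpha]; last first.
    rewrite -ltnNge => ka.
    have [j gj] : exists j, (g j < alpha j)%N.
      apply/existsP; rewrite -[X in is_true X]negbK negb_exists; apply/negP => /forallP /= h.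
      move: ka; apply/negP; rewrite -leqNgt; apply: leq_trans gk.
      by apply: leq_sum => j _; rewrite leqNgt h.
    by rewrite (bigD1 j) //= T0 // mul0r.
  apply: eq_bigr => alpha _; rewrite /T big_split /= bigA_distr_bigA /= mulr_suml.
  by apply: eq_bigr => beta _; rewrite /W !big_split /= mulrA.
rewrite /mpeval mevalE.
transitivity (\sum_(m <- msupp p) mcoeff m p *
    \sum_(alpha : {ffun 'I_N -> 'I_k.+1} | (\sum_j alpha j <= k)%N)
      \sum_(beta : {ffun 'I_N -> 'I_k.+1}) (\prod_j X j (beta j) ^+ m j) * W alpha beta).
  rewrite big_seq [RHS]big_seq; apply: eq_bigr => m mp; congr (_ * _).
  apply: monomial; rewrite -mdegE -ltnS; apply: leq_trans sp.
  exact: msize_mdeg_lt.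
under eq_bigr do rewrite mulr_sumr.
rewrite exchange_big /=; apply: eq_bigr => alpha _.
under eq_bigr do rewrite mulr_sumr.
rewrite exchange_big /=; apply: eq_bigr => beta _.
rewrite -/(W alpha beta) mevalE mulr_suml; apply: eq_bigr => m _.
rewrite mulrA; congr (_ * _ * _); apply: eq_bigr => j _.
by rewrite /grid_point mxE.
Qed.

(** The weight of [beta] is zero unless [beta <= alpha] in each coordinate, so only grid points in
    [nodes X k] contribute. There are at most [k.+1 ^ (2 * N)] pairs [(alpha, beta)]. *)
Lemma mpeval_le_nodes {R : realType} {N k : nat} (X : 'I_N -> nat -> R) (p : mpoly N R)
    (x : 'rV[R]_N) (D : R) :
  (forall j, injective (X j)) -> (msize p <= k.+1)%N -> 0 <= D ->
  (forall a, nodes X k a -> `|mpeval p a| <= 1) ->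
  (forall j (a b : 'I_k.+1), `|newton_weight (X j) a b * newton_poly (X j) a (x 0 j)| <= D) ->
  `|mpeval p x| <= (k.+1%:R ^+ 2 * D) ^+ N.
Proof.
move=> XI sp D0 ple wle; rewrite (mpeval_newton X p x XI sp).
apply: (@le_trans _ _ (\sum_(alpha : {ffun 'I_N -> 'I_k.+1})
  \sum_(beta : {ffun 'I_N -> 'I_k.+1}) D ^+ N)); last first.
  rewrite !sumr_const !card_ffun !card_ord -mulrnA -[_ *+ _]mulr_natl.
  by rewrite natrM !natrX -!exprMn expr2.
apply: le_trans (ler_norm_sum _ _ _) _; rewrite big_mkcond /=.
apply: ler_sum => alpha _; case: ifP => [ak | _]; last first.
  by rewrite sumr_ge0 // => beta _; rewrite exprn_ge0.
apply: le_trans (ler_norm_sum _ _ _) _; apply: ler_sum => beta _.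
rewrite normrM normr_prod.
have W_le : \prod_j `|newton_weight (X j) (alpha j) (beta j) *
    newton_poly (X j) (alpha j) (x 0 j)| <= D ^+ N.
  rewrite -[N in D ^+ N]card_ord -prodr_const; apply: ler_prod => j _.
  by rewrite normr_ge0 wle.
have [bk | bk] := leqP (\sum_j beta j) k.
  rewrite -[D ^+ N]mul1r ler_pM ?normr_ge0 ?prodr_ge0 //.
  by apply: ple; exists (fun j => beta j).
(* Outside [nodes X k] the value of [p] is not controlled, but a weight vanishes. *)
have [j ab] : exists j, (alpha j < beta j)%N.
  apply/existsP; rewrite -[X in is_true X]negbK negb_exists; apply/negP => /forallP /= h.
  move: bk; apply/negP; rewrite -leqNgt; apply: leq_trans ak.
  by apply: leq_sum => j _; rewrite leqNgt h.
rewrite [X in _ * X](bigD1 j) //= {1}/newton_weight leqNgt ab mul0r normr0 mul0r mulr0.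
exact: exprn_ge0.
Qed.

(** * Real Leja sequences and the Lebesgue constant *)

Lemma trace_Re {R : realType} (z : R[i]) : trace z = (2 * complex.Re z)%:C%C.
Proof. by rewrite rmorphM /= rmorph_nat ReJ_add mulrC divfK ?pnatr_eq0. Qed.

Lemma trace_dist_Re {R : realType} (z w : R[i]) :
  `|trace z - trace w| = (2 * `|complex.Re z - complex.Re w|)%:C%C.
Proof.
rewrite !trace_Re -rmorphB -mulrBr normc_def /= expr0n addr0 sqrtr_sqr normrM.
by rewrite ger0_norm.
Qed.

Lemma is_re_leja_projection {R : realType} (X : nat -> R) : is_re_leja X ->
  injective X /\ exists e y : nat -> R[i],
  [/\ forall k, leja_section k e, leja_projection e y & forall k, X k = complex.Re (y k)].
Proof.
case=> e [[e0 eD eM] [phi [phiI phiR XE]]].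
have eL k : leja_section k e.
  by split=> // j /andP[j0 _]; split=> [|z z1]; [exact: eD | exact: eM].
have phi_new k m : (m < phi k)%N -> complex.Re (e m) <> complex.Re (e (phi k)).
  have : range phi (phi k) by exists k.
  by rewrite phiR; apply.
have trace_eq (z w : R[i]) : trace z = trace w <-> complex.Re z = complex.Re w.
  rewrite !trace_Re; split=> [/(congr1 (@complex.Re R)) /= | -> //].
  by apply: mulfI; rewrite pnatr_eq0.
split.
  move=> i j; rewrite !XE => eij.
  have [lij | lji | //] := ltngtP i j.
    by case: (phi_new j (phi i) (phiI _ _ lij)).
  by case: (phi_new i (phi j) (phiI _ _ lji)).
exists e, (e \o phi); split=> //.
apply: first_occurrences_projection => // [k m mk /trace_eq | n nP].
  exact: phi_new.
have : range phi n by rewrite phiR => m mn /trace_eq; apply: nP.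
by case=> k _ <-; exists k.
Qed.

(** Both products have [a] factors, so passing from traces to real parts costs [2 ^+ a] in each, and
    this cancels in the quotient. The constant is [16 * 4]. *)
Lemma re_leja_weight_le {R : realType} (X : nat -> R) (a b : nat) (t : R) :
  is_re_leja X -> -1 <= t <= 1 ->
  `|newton_weight X a b * newton_poly X a t| <= 64%:R * a.+1%:R ^+ 4.
Proof.
move=> /is_re_leja_projection[XI [e [y [eL yP XE]]]] t1.
rewrite /newton_weight; case: leqP => ba; last first.
  by rewrite mul0r normr0 mulr_ge0 ?exprn_ge0 ?ler0n.
(* The point of the upper unit half circle above [t]. *)
pose z : R[i] := (t +i* Num.sqrt (1 - t ^+ 2))%C.
have z1 : `|z| = 1.
  rewrite normc_def /= sqr_sqrtr; last first.
    rewrite -[1](expr1n _ 2) subr_sqr mulr_ge0 //; lra.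
  by rewrite addrC subrK sqrtr1.
have up := projection_prod_le e y z a eL yP z1.
have lo := projection_derivative_ge e y b a eL yP ba.
have {}up : 2 ^+ a * `|newton_poly X a t| <= 16%:R * a.+1%:R ^+ 2.
  rewrite -lecR; apply: le_trans (le_trans up _).
    rewrite /newton_poly normr_prod -[a in 2 ^+ a]card_ord -prodr_const -big_split /=.
    rewrite rmorph_prod /=; apply: ler_prod => m _.
    by rewrite lecR mulr_ge0 //= trace_dist_Re XE.
  by rewrite rmorphM rmorphXn /= !rmorph_nat.
pose V := \prod_(m < a.+1 | m != b :> nat) (X b - X m).
have {}lo : 1 <= 4%:R * a.+1%:R ^+ 2 * (2 ^+ a * `|V|).
  rewrite -lecR; apply: le_trans lo _.
  rewrite !rmorphM !rmorphXn /= !rmorph_nat ler_wpM2l ?mulr_ge0 ?exprn_ge0 ?ler0n //.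
  (* Among [a.+1] indices, the one equal to [b] is left out. *)
  have -> : (2 : R[i]) ^+ a = \prod_(m < a.+1 | m != b :> nat) 2.
    rewrite prodr_const; congr (_ ^+ _).
    by have := cardC1 (Ordinal (ba : b < a.+1)%N); rewrite card_ord /= => E; rewrite -[LHS]E; apply: eq_card.
  rewrite /V normr_prod rmorph_prod -big_split /=; apply: ler_prod => m _.
  by rewrite normr_ge0 trace_dist_Re !XE rmorphM /= rmorph_nat.
have V0 : 0 < `|V|.
  rewrite lt_neqAle normr_ge0 andbT; apply: contraTneq lo => <-.
  by rewrite !mulr0 ler10.
rewrite normrM normfV mulrC ler_pdivrMr // -(ler_pM2l (exprn_gt0 a (ltr0n R 2))).
apply: le_trans up _; rewrite -[X in X <= _]mulr1.
apply: le_trans (ler_wpM2l _ lo) _; first by rewrite mulr_ge0 ?exprn_ge0 ?ler0n.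
by rewrite le_eqVlt; apply/orP; left; apply/eqP; rewrite -/V; ring.
Qed.

Theorem theorem3p2 (R : realType) (N : nat) (hN : (1 <= N)%N)
    (X : 'I_N -> nat -> R) (hX : forall j : 'I_N, is_re_leja (X j)) :
  exists C q : R, [/\ 0 < C, 0 < q &
    forall k : nat, (1 <= k)%N ->
      (lebesgue_constant k (nodes X k) <= (C * k%:R `^ q)%:E)%E].
Proof.
(* Each coordinate contributes [k.+1 ^ 2 * 64 * k.+1 ^ 4], and [k.+1 <= 2 * k] turns this into
   [2 ^ 6 * 2 ^ 6 * k ^ 6]. *)
exists ((2 ^+ 12) ^+ N), (6 * N)%:R; split=> [||k k1].
- by rewrite !exprn_gt0 // ltr0n.
- by rewrite ltr0n muln_gt0.
apply: ge_ereal_sup => _ [f [_ f1] <-]; apply: ge_ereal_sup => _ [x xcube <-].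
rewrite lee_fin powR_mulrn ?ler0n // exprM -exprMn.
set p := interpolant _ _ _.
(* [xget] returns either a genuine interpolant or its default 0, for which the bound is trivial. *)
have [p0 | [sp pf]] : p = 0 \/ (msize p <= k.+1)%N /\
    forall a, nodes X k a -> mpeval p a = f a.
  by rewrite /p /interpolant; case: xgetP => [q _ | _]; [right | left].
  rewrite p0 /mpeval meval0 normr0 exprn_ge0 // mulr_ge0 ?exprn_ge0 ?ler0n //.
have f_le a : cube a -> `|f a| <= 1.
  move=> ca; rewrite -lee_fin; apply: le_trans f1.
  by apply: ereal_sup_ubound; exists a.
have pow4 (a : 'I_k.+1) : 64%:R * (a : nat).+1%:R ^+ 4 <= 64%:R * k.+1%:R ^+ 4 :> R.
  by rewrite ler_wpM2l // lerXn2r ?nnegrE ?ler0n // ler_nat.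
have bound := mpeval_le_nodes X p x (64%:R * k.+1%:R ^+ 4) _ sp _ _ _.
apply: le_trans (bound _ _ _ _) _.
- by move=> j; case: (is_re_leja_projection _ (hX j)).
- by rewrite mulr_ge0 ?exprn_ge0 ?ler0n.
- move=> a na; rewrite pf //; apply: f_le.
  case: na => alpha _ <- j; rewrite mxE.
  have [_ [e [y [eL yP XE]]]] := is_re_leja_projection _ (hX j).
  rewrite XE -ler_norml -lecR (le_trans (normc_ge_Re _)) //.
  by rewrite (norm_projection e y).
- by move=> j a b; apply: le_trans (re_leja_weight_le _ _ _ _ (hX j) (xcube j)) (pow4 a).
rewrite lerXn2r ?nnegrE ?mulr_ge0 ?exprn_ge0 ?ler0n //.
have -> : 64%:R = 2 ^+ 6 :> R by ring.
rewrite mulrCA -exprD (exprD _ 6 6) -[leRHS]mulrA.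
apply: ler_wpM2l; first by rewrite exprn_ge0.
rewrite -exprMn lerXn2r ?nnegrE ?mulr_ge0 ?ler0n //.
by rewrite -natrM ler_nat mul2n -addnn -addn1 leq_add2l.
Qed.
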